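(* Let $\alpha\ge \frac{\sqrt2\,\sqrt[4]{3}}{\sqrt{\pi}}$. There exist $c>0$ and $n_0$, depending only on $\alpha$, such that every generic $\alpha$-dense set $P$ of $n\ge n_0$ points in the plane satisfies $\operatorname{cr}(P)\ge cn$.
   Context: A set $P$ of $n$ points in the plane, rescaled so that its minimum pairwise distance is $1$, is $\alpha$-dense if its diameter is less than $\alpha\sqrt n$. A finite planar point set is in general position if no three of its points are collinear; it is generic if it is in general position and every subset has a unique Euclidean minimum spanning tree (MST). For a generic set $X$, $T_X$ denotes its MST, drawn with straight-line edges. For disjoint $R,B$ with $R\cup B$ generic, $\operatorname{cr}(R,B)$ is the number of crossings between the edges of $T_R$ and the edges of $T_B$, and for generic $P$, $\operatorname{cr}(P)=\max\operatorname{cr}(R,B)$ over all partitions $P=R\cup B$ into two disjoint sets. *)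

(* Defs.v *)
From HB Require Import structures.
From mathcomp Require Import all_boot all_order all_algebra.
From mathcomp Require Import all_classical all_reals.
From mathcomp Require Import trigo.
Set Implicit Arguments. Unset Strict Implicit. Unset Printing Implicit Defensive.
Import Order.TTheory GRing.Theory Num.Theory.
Local Open Scope ring_scope.

Section Geometry.
Variable R : realType.
Definition pt := (R * R)%type.

Definition dist (a b : pt) : R :=
  Num.sqrt ((a.1 - b.1) ^+ 2 + (a.2 - b.2) ^+ 2).

Definition collinear (a b c : pt) : Prop :=
  (b.1 - a.1) * (c.2 - a.2) - (b.2 - a.2) * (c.1 - a.1) = 0.

Definition seg_cross (a b c d : pt) : Prop :=
  exists t s : R, 0 <= t <= 1 /\ 0 <= s <= 1 /\
    a.1 + t * (b.1 - a.1) = c.1 + s * (d.1 - c.1) /\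
    a.2 + t * (b.2 - a.2) = c.2 + s * (d.2 - c.2).

Variable n : nat.
Variable p : 'I_n -> pt.

Definition spanning_tree (A : {set 'I_n}) (T : {set {set 'I_n}}) : bool :=
  [forall e in T, (#|e| == 2)%N && (e \subset A)] &&
  (#|T| == #|A| - 1)%N &&
  [forall x in A, forall y in A, connect [rel u v | [set u; v] \in T] x y].

Definition weight (T : {set {set 'I_n}}) : R :=
  \sum_(i : 'I_n) \sum_(j : 'I_n | (i < j)%N && ([set i; j] \in T))
     dist (p i) (p j).

Definition is_mst (A : {set 'I_n}) (T : {set {set 'I_n}}) : bool :=
  spanning_tree A T &&
  [forall T' : {set {set 'I_n}}, spanning_tree A T' ==> (weight T <= weight T')].

(* the MST T_A (well defined when it is unique, i.e. for generic sets) *)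
Definition mst (A : {set 'I_n}) : {set {set 'I_n}} :=
  odflt (finset.set0 : {set {set 'I_n}}) [pick T | is_mst A T].

Definition general_position : Prop :=
  forall i j k : 'I_n, i != j -> j != k -> i != k ->
    ~ collinear (p i) (p j) (p k).

Definition generic : Prop :=
  injective p /\ general_position /\
  forall A : {set 'I_n}, exists! T, is_mst A T.

(* alpha-dense: diameter < alpha * sqrt n * (minimum pairwise distance),
   i.e. after rescaling the minimum distance to 1, diameter < alpha sqrt n *)
Definition dense (alpha : R) : Prop :=
  forall i j k l : 'I_n, k != l ->
    dist (p i) (p j) < alpha * Num.sqrt n%:R * dist (p k) (p l).

Definition cr (Rs B : {set 'I_n}) : nat :=
  #|[set q : ('I_n * 'I_n) * ('I_n * 'I_n) |
      [&& (q.1.1 < q.1.2)%N, [set q.1.1; q.1.2] \in mst Rs,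
          (q.2.1 < q.2.2)%N, [set q.2.1; q.2.2] \in mst B &
          `[< seg_cross (p q.1.1) (p q.1.2) (p q.2.1) (p q.2.2) >]]]|.

Definition crP : nat :=
  \max_(Rs : {set 'I_n}) cr Rs (~: Rs).

End Geometry.

(* Main.v *)
Require Import Defs.
From HB Require Import structures.
From mathcomp Require Import all_boot all_order all_algebra.
From mathcomp Require Import all_classical all_reals.
From mathcomp Require Import trigo.
From mathcomp Require Import ring lra zify.
Set Implicit Arguments. Unset Strict Implicit. Unset Printing Implicit Defensive.
Import Order.TTheory GRing.Theory Num.Theory.
Local Open Scope ring_scope.

(* Call nine points a # pattern when four of their chords form the shape #
   (two roughly horizontal, two roughly vertical) around the ninth point q. The
   shortest edge xy from the points in the middle region of the # to all the
   other points lies in the minimum spanning tree of every set containing x and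
   y, and it leaves the middle region through some chord cd of which neither x
   nor y is an endpoint. So if c and d are blue and all points nearby are red,
   then xy and cd are edges of the two trees, and they cross.

   Subdivide the plane into squares of side 5^t eps, where squares of side eps
   contain at most one point. If a square of side 5^t eps contains more than
   24^t points, then some subsquare on some level has all of its 25 children
   inhabited, which yields a # pattern. A dense set has linearly many such
   squares once t is large in terms of alpha; a ninth of them are pairwise at
   least two squares apart, and the chords found there can all be coloured blue
   simultaneously. *)

(** * Spanning trees: edge exchange and the cut property *)

Lemma first_exit (T : finType) (X : {set T}) (x : T) (s : seq T) :
  x \in X -> last x s \notin X ->
  exists s1 v s2, [/\ s = s1 ++ v :: s2, last x s1 \in X & v \notin X].
Proof.
elim: s x => [|v s IHs] x xX /=; first by rewrite xX.
have [vX lastX|vX _] := boolP (v \in X); last by exists [::], v, s.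
have [s1 [w [s2 [-> s1X wX]]]] := IHs v vX lastX.
by exists (v :: s1), w, s2.
Qed.

(** Defined for every index set but meant for pairs, where the sum has a single term. It turns
    [weight] into a sum over edges, in which one edge is easily replaced. *)
Definition edge_len (R : realType) (n : nat) (p : 'I_n -> pt R)
    (e : {set 'I_n}) : R :=
  \sum_(q : 'I_n * 'I_n | (q.1 < q.2)%N && ([set q.1; q.2] == e))
     dist (p q.1) (p q.2).

Lemma distC (R : realType) (a b : pt R) : dist a b = dist b a.
Proof. by rewrite /dist -opprB sqrrN -(opprB b.2) sqrrN. Qed.

Lemma weightE (R : realType) (n : nat) (p : 'I_n -> pt R)
    (T : {set {set 'I_n}}) :
  weight p T = \sum_(e in T) edge_len p e.
Proof.
rewrite /weight pair_big_dep /=.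
rewrite (partition_big (fun q : 'I_n * 'I_n => [set q.1; q.2]) (mem T)) /=;
  last by move=> q /andP[].
apply: eq_bigr => e eT; apply: eq_bigl => q.
by have [->|_] := eqVneq; rewrite ?andbF ?andbT // eT andbT.
Qed.

Lemma set2_eq_ltn (n : nat) (x y u v : 'I_n) :
  (x < y)%N -> (u < v)%N -> [set u; v] = [set x; y] -> (u, v) = (x, y).
Proof.
move=> xy uv E.
have : u \in [set x; y] by rewrite -E set21.
have : v \in [set x; y] by rewrite -E set22.
rewrite !inE => /orP[]/eqP ? /orP[]/eqP ?; subst => //.
- by rewrite ltnn in uv.
- by have := ltn_trans xy uv; rewrite ltnn.
- by rewrite ltnn in uv.
Qed.

Lemma edge_len_pair (R : realType) (n : nat) (p : 'I_n -> pt R) (x y : 'I_n) :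
  x != y -> edge_len p [set x; y] = dist (p x) (p y).
Proof.
wlog xy : x y / (x < y)%N => [H|_].
  have [xy|yx|E] := ltngtP x y; first exact: H.
    by move=> xny; rewrite finset.setUC H ?(eq_sym y) // distC.
  by rewrite (val_inj E) eqxx.
rewrite /edge_len (bigD1 (x, y)) /= ?xy ?eqxx // big1 ?addr0 // => -[u v] /=.
case/andP=> /andP[uv /eqP E] /eqP[]; exact: set2_eq_ltn E.
Qed.

Lemma set2_neq (T : finType) (u v a b : T) :
  u != a -> u != b -> [set a; b] != [set u; v].
Proof.
move=> ua ub; apply/eqP => E; have := set21 u v.
by rewrite -E !inE (negPf ua) (negPf ub).
Qed.

(* Exchange: removing from a spanning tree [T] an edge [{u,v}] of the [T]-path
   from [x] to [y] and adding [{x,y}] gives a spanning tree again. *)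
Lemma spanning_tree_exchange (n : nat) (A X : {set 'I_n})
    (T : {set {set 'I_n}}) (x y : 'I_n) :
  spanning_tree A T -> x \in A -> y \in A -> x \in X -> y \notin X ->
  [set x; y] \notin T ->
  exists u v, [/\ u \in A, v \in A, u \in X & v \notin X] /\
    [set u; v] \in T /\ spanning_tree A ([set x; y] |: (T :\ [set u; v])).
Proof.
move=> /andP[/andP[/forallP edgesT /eqP cardT] connT] xA yA xX yX xyT.
have xny : x != y by apply: contraNneq yX => <-.
have /connectP[s0 path0 lasty0] : connect [rel u v | [set u; v] \in T] x y.
  by move: connT => /forall_inP/(_ x xA)/forall_inP/(_ y yA).
(* On a simple path the edge from [u] to [v] occurs only once, so the pieces before and after it
   survive its removal. *)
move: lasty0; case: (shortenP path0) => s path_s uniq_s _ lasty {s0 path0}.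
have lastX : last x s \notin X by rewrite -lasty.
have [s1 [v [s2 [Es uX vX]]]] := first_exit xX lastX.
move: path_s uniq_s lasty; rewrite {lastX}Es -cat_cons cat_uniq cat_path last_cat /=.
set u := last x s1 in uX * => /and3P[path1 uvT path2] uniq_s lasty.
have uA : u \in A.
  move: (edgesT [set u; v]); rewrite uvT => /andP[_ /fintype.subsetP]; apply.
  exact: set21.
have vA : v \in A.
  move: (edgesT [set u; v]); rewrite uvT => /andP[_ /fintype.subsetP]; apply.
  exact: set22.
exists u, v; do 2!split=> //.
set T' := _ |: _; set r' := [rel a b | [set a; b] \in T'].
have symr' a b : connect r' a b = connect r' b a.
  by apply: sym_connect_sym => c d; rewrite /r' /= finset.setUC.
have inT' a b : [set a; b] \in T -> [set a; b] != [set u; v] -> r' a b.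
  by move=> abT abuv; rewrite /r' /T' /= !inE abT abuv orbT.
have vs1 : v \notin x :: s1.
  by case/and3P: uniq_s => _; rewrite negb_or => /andP[].
have us2 : u \notin v :: s2.
  case/and3P: uniq_s => _; rewrite negb_or => /andP[_ /hasPn us2] _.
  rewrite inE negb_or; apply/andP; split; first by apply: contraNneq vX => <-.
  by apply/negP => /us2; rewrite mem_last.
have xu : connect r' x u.
  apply/connectP; exists s1 => //.
  apply: (@sub_in_path _ (mem (x :: s1))) path1; last by apply/allP.
  move=> a b /= as1 bs1 abT; apply: inT' => //.
  rewrite [X in _ != X]finset.setUC; apply: set2_neq.
    by apply: contraNneq vs1 => ->.
  by apply: contraNneq vs1 => ->.
have vy : connect r' v y.
  apply/connectP; exists s2 => //.
  apply: (@sub_in_path _ (mem (v :: s2))) path2; last by apply/allP.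
  move=> a b /= as2 bs2 abT; apply: inT' => //.
  apply: set2_neq.
    by apply: contraNneq us2 => ->.
  by apply: contraNneq us2 => ->.
(* The removed edge is bypassed: back from [u] to [x], over the new edge to [y], and back to [v]. *)
have uv : connect r' u v.
  rewrite symr' in xu; apply: connect_trans xu _.
  rewrite symr' in vy; apply: connect_trans _ vy.
  by apply: connect1; rewrite /r' /T' /= !inE eqxx.
have xynuv : [set x; y] != [set u; v] by apply: contraNneq xyT => ->.
rewrite /spanning_tree; apply/andP; split; first (apply/andP; split).
- apply/forallP => e; apply/implyP; rewrite /T' !inE => /orP[/eqP->|/andP[_]].
    rewrite cards2 xny /=; apply/fintype.subsetP => a.
    by rewrite !inE => /orP[]/eqP->.
  by move: (edgesT e) => /implyP.
- rewrite /T' cardsU1 !inE negb_and (negPf xyT) orbT -cardT.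
  by rewrite (cardsD1 [set u; v] T) uvT.
- apply/forall_inP => a aA; apply/forall_inP => b bA.
  have /connect_sub : subrel [rel u v | [set u; v] \in T] (connect r').
    move=> c d /= cdT.
    have [/eqP|cduv] := boolP ([set c; d] == [set u; v]); last first.
      by apply/connect1/inT'.
    move=> E; have : c \in [set u; v] by rewrite -E set21.
    have : d \in [set u; v] by rewrite -E set22.
    rewrite !inE => /orP[]/eqP-> /orP[]/eqP->; rewrite ?connect0 //.
    by rewrite symr'.
  by apply; move: connT => /forall_inP/(_ a aA)/forall_inP/(_ b bA).
Qed.

(** If the edge were missing, an exchange would give a second spanning tree that is no heavier,
    against uniqueness. Hence a weak inequality between the lengths suffices. *)
Lemma mst_cut (R : realType) (n : nat) (p : 'I_n -> pt R)
    (A X : {set 'I_n}) (x y : 'I_n) :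
  (exists! T, is_mst p A T) -> x \in A -> y \in A -> x \in X -> y \notin X ->
  (forall u v, u \in A -> v \in A -> u \in X -> v \notin X ->
    dist (p x) (p y) <= dist (p u) (p v)) ->
  [set x; y] \in mst p A.
Proof.
move=> [T0 [mstT0 uniqT0]] xA yA xX yX minxy.
rewrite /mst; case: pickP => [T mstT|/(_ T0)]; last by rewrite mstT0.
rewrite /=; apply/negPn/negP => xyT.
case/andP: (mstT) => stT /forallP minT.
have [u [v [[uA vA uX vX] [uvT stT']]]] :=
  spanning_tree_exchange stT xA yA xX yX xyT.
set T' := _ |: _ in stT'.
have xny : x != y by apply: contraNneq yX => <-.
have unv : u != v by apply: contraNneq vX => <-.
have wT' : weight p T' <= weight p T.
  rewrite !weightE /T' big_setU1 ?inE ?negb_and ?xyT ?orbT //=.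
  by rewrite [X in _ <= X](big_setD1 _ uvT) /= lerD2r !edge_len_pair // minxy.
have mstT' : is_mst p A T'.
  rewrite /is_mst stT'; apply/forallP => S; apply/implyP => stS.
  by apply: le_trans wT' _; have /implyP := minT S; apply.
move: xyT; rewrite -(uniqT0 _ mstT) (uniqT0 _ mstT').
by rewrite /T' !inE eqxx.
Qed.

(** * Orientation determinants and leaving a region bounded by chords *)

(** Twice the signed area of the triangle [a], [b], [c]: positive when [c] lies to the left of the
    line from [a] to [b]. *)
Definition det (R : realType) (a b c : pt R) : R :=
  (b.1 - a.1) * (c.2 - a.2) - (b.2 - a.2) * (c.1 - a.1).

Definition along (R : realType) (x y : pt R) (s : R) : pt R :=
  (x.1 + s * (y.1 - x.1), x.2 + s * (y.2 - x.2)).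

Lemma det_along (R : realType) (a b x y : pt R) (s : R) :
  det a b (along x y s) = (1 - s) * det a b x + s * det a b y.
Proof. by rewrite /det /along /=; ring. Qed.

(** The witness is the parameter of the orthogonal projection of [z] to the line; in each coordinate
    the error is a multiple of [det a b z]. *)
Lemma det_eq0_along (R : realType) (a b z : pt R) :
  a <> b -> det a b z = 0 -> exists t, z = along a b t.
Proof.
move=> ab det0.
set N := (b.1 - a.1) ^+ 2 + (b.2 - a.2) ^+ 2.
have N0 : N != 0.
  rewrite /N paddr_eq0 ?sqr_ge0 // !sqrf_eq0 !subr_eq0.
  apply/negP => /andP[/eqP E1 /eqP E2]; apply: ab.
  by rewrite (surjective_pairing a) (surjective_pairing b) E1 E2.
exists (((z.1 - a.1) * (b.1 - a.1) + (z.2 - a.2) * (b.2 - a.2)) / N).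
rewrite (surjective_pairing z) /along; congr pair; apply: (mulIf N0).
  rewrite mulrDl [X in _ + X]mulrAC divfK //.
  apply/eqP; rewrite -subr_eq0; apply/eqP.
  by transitivity (- (b.2 - a.2) * det a b z); [rewrite /N /det; ring|rewrite det0 mulr0].
rewrite mulrDl [X in _ + X]mulrAC divfK //.
apply/eqP; rewrite -subr_eq0; apply/eqP.
by transitivity ((b.1 - a.1) * det a b z); [rewrite /N /det; ring|rewrite det0 mulr0].
Qed.

(* Walking from [x] to [y], stop at the first zero of one of the functionals. *)
Lemma first_sign_change (R : realType) (K : finType) (F G : K -> R) :
  (forall k, 0 < F k) -> (exists k, G k < 0) ->
  exists k s, [/\ 0 <= s <= 1, G k < 0, (1 - s) * F k + s * G k = 0
    & forall j, 0 <= (1 - s) * F j + s * G j].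
Proof.
move=> F0 [k0 Gk0].
(* The time at which the functional of [k] vanishes, if [G k] is negative. *)
pose t k := F k / (F k - G k).
have [k Gk mink] := @arg_minP _ R K k0 (fun k => G k < 0) t Gk0.
have den j : G j < 0 -> 0 < F j - G j.
  by move=> Gj; rewrite subr_gt0 (lt_trans Gj).
have tk : t k * (F k - G k) = F k by rewrite divfK ?gt_eqF ?den.
have tk0 : 0 <= t k by rewrite divr_ge0 // ltW ?den.
have tk1 : t k <= 1 by rewrite ler_pdivrMr ?den // mul1r lerDl oppr_ge0 ltW.
exists k, (t k); split => //; first by rewrite tk0.
  by rewrite mulrBl mul1r -addrA [- _ + _]addrC -mulrBr -opprB mulrN tk subrr.
move=> j; have [Gj|Gj] := leP 0 (G j).
  by apply: addr_ge0; rewrite mulr_ge0 ?subr_ge0 // ltW.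
have := mink j Gj; rewrite {2}/t ler_pdivlMr ?den // mulrBr => H.
by rewrite mulrBl mul1r; lra.
Qed.

(* The region [forall k, 0 < det (a k) (b k) z] is bounded by the chords, each
   of which sticks out of it at both ends. *)
Lemma exit_crosses_chord (R : realType) (K : finType) (a b : K -> pt R)
    (x y : pt R) :
  (forall k, exists j, det (a j) (b j) (a k) < 0 < det (a j) (b j) (b k)) ->
  (forall k, exists j, det (a j) (b j) (b k) < 0 < det (a j) (b j) (a k)) ->
  (forall k, 0 < det (a k) (b k) x) -> (exists k, det (a k) (b k) y < 0) ->
  exists k, det (a k) (b k) y < 0 /\ seg_cross x y (a k) (b k).
Proof.
move=> outa outb xin yout.
have [k [s [s01 yk zk zin]]] := first_sign_change xin yout.
exists k; split=> //; pose z := along x y s.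
have zF j : 0 <= det (a j) (b j) z by rewrite det_along.
have [j /andP[ja jb]] := outa k; have [j' /andP[jb' ja']] := outb k.
have ab : a k <> b k.
  by move=> E; move: ja jb; rewrite E => /lt_trans H /H; rewrite ltxx.
have [|t zE] := @det_eq0_along _ _ _ z ab; first by rewrite det_along.
exists s, t; split=> //; split.
  (* The functional of [j] is negative at [a k] and positive at [b k], so its nonnegativity at [z]
     forces [0 <= t]; likewise [j'] forces [t <= 1]. *)
  have := zF j; have := zF j'; rewrite zE !det_along => H1 H2.
  by apply/andP; split; nra.
by move: zE; rewrite /z /along => -[-> ->].
Qed.

(** Expanded around [z], the determinant is a sum of two products of positive factors. The next
    three lemmas differ by signs or by an exchange of the axes. *)
Lemma det_above (R : realType) (a b z : pt R) :
  a.1 < z.1 < b.1 -> a.2 < z.2 -> b.2 < z.2 -> 0 < det a b z.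
Proof.
move=> /andP[az zb] az2 bz2.
have -> : det a b z =
    (b.1 - z.1) * (z.2 - a.2) + (z.1 - a.1) * (z.2 - b.2) by rewrite /det; ring.
by apply: addr_gt0; rewrite mulr_gt0 ?subr_gt0.
Qed.

Lemma det_below (R : realType) (a b z : pt R) :
  a.1 < z.1 < b.1 -> z.2 < a.2 -> z.2 < b.2 -> det a b z < 0.
Proof.
move=> /andP[az zb] az2 bz2.
have -> : det a b z =
    - ((b.1 - z.1) * (a.2 - z.2) + (z.1 - a.1) * (b.2 - z.2)).
  by rewrite /det; ring.
by rewrite oppr_lt0; apply: addr_gt0; rewrite mulr_gt0 ?subr_gt0.
Qed.

Lemma det_left (R : realType) (a b z : pt R) :
  a.2 < z.2 < b.2 -> z.1 < a.1 -> z.1 < b.1 -> 0 < det a b z.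
Proof.
move=> /andP[az zb] az1 bz1.
have -> : det a b z =
    (b.2 - z.2) * (a.1 - z.1) + (z.2 - a.2) * (b.1 - z.1) by rewrite /det; ring.
by apply: addr_gt0; rewrite mulr_gt0 ?subr_gt0.
Qed.

Lemma det_right (R : realType) (a b z : pt R) :
  a.2 < z.2 < b.2 -> a.1 < z.1 -> b.1 < z.1 -> det a b z < 0.
Proof.
move=> /andP[az zb] az1 bz1.
have -> : det a b z =
    - ((b.2 - z.2) * (z.1 - a.1) + (z.2 - a.2) * (z.1 - b.1)).
  by rewrite /det; ring.
by rewrite oppr_lt0; apply: addr_gt0; rewrite mulr_gt0 ?subr_gt0.
Qed.

Lemma det_swap (R : realType) (a b z : pt R) : det b a z = - det a b z.
Proof. by rewrite /det; ring. Qed.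

Lemma seg_crossCl (R : realType) (a b c d : pt R) :
  seg_cross a b c d -> seg_cross b a c d.
Proof.
move=> [t [s [/andP[t0 t1] [s01 [E1 E2]]]]]; exists (1 - t), s.
split; first by apply/andP; split; lra.
by split=> //; rewrite -E1 -E2; split; ring.
Qed.

Lemma seg_crossC (R : realType) (a b c d : pt R) :
  seg_cross a b c d -> seg_cross c d a b.
Proof. by move=> [t [s [t01 [s01 [E1 E2]]]]]; exists s, t; do 3!split=> //. Qed.

Lemma seg_crossCr (R : realType) (a b c d : pt R) :
  seg_cross a b c d -> seg_cross a b d c.
Proof. by move=> /seg_crossC/seg_crossCl/seg_crossC. Qed.

Lemma normB_le_dist (R : realType) (a b : pt R) :
  `|a.1 - b.1| <= dist a b /\ `|a.2 - b.2| <= dist a b.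
Proof.
by split; rewrite -sqrtr_sqr ler_wsqrtr // ?lerDl ?lerDr sqr_ge0.
Qed.

Lemma dist_le_normB (R : realType) (a b : pt R) :
  dist a b <= `|a.1 - b.1| + `|a.2 - b.2|.
Proof.
have s0 : 0 <= `|a.1 - b.1| + `|a.2 - b.2| by apply: addr_ge0.
rewrite -(ger0_norm s0) -(sqrtr_sqr (_ + _)); apply: ler_wsqrtr.
rewrite [leRHS]sqrrD !real_normK ?num_real // lerD2r lerDl mulrn_wge0 //.
exact: mulr_ge0.
Qed.

(** * Counting points in the nested squares *)

(** [a] and [b] stand for integer coordinates on the finest grid; division by [5 ^ t] gives the
    square of level [t]. *)
Definition cell (I : finType) (a b : I -> nat) (t X Y : nat) : {set I} :=
  [set i | (a i %/ 5 ^ t == X)%N && (b i %/ 5 ^ t == Y)%N].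

(* [h e s]: end [s] (left/right) of the lower/upper ([e]) horizontal chord;
   [v e s]: end [s] (bottom/top) of the left/right ([e]) vertical chord;
   [q]: a point in the middle square of the resulting # shape. *)
Definition hash_pattern (I : finType) (lx ly : rel I) (D : {set I})
    (h v : bool -> bool -> I) (q : I) : Prop :=
  [/\ q \in D,
      forall e s, h e s \in D /\ v e s \in D,
      forall e s, [/\ lx (h e false) (v false s), lx (v false s) q,
                      lx q (v true s) & lx (v true s) (h e true)]
    & forall e s, [/\ ly (v e false) (h false s), ly (h false s) q,
                      ly q (h true s) & ly (h true s) (v e true)]].

Lemma mem_subcell (I : finType) (a b : I -> nat) (t X Y u v : nat) :
  (u < 5)%N -> (v < 5)%N ->
  {subset cell a b t (5 * X + u) (5 * Y + v) <= cell a b t.+1 X Y}.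
Proof.
move=> u5 v5 i; rewrite !inE expnSr !divnMA => /andP[/eqP-> /eqP->].
by rewrite !(mulnC 5) !divnMDl // !divn_small // !addn0 !eqxx.
Qed.

Lemma card_cell_rec (I : finType) (a b : I -> nat) (t X Y : nat) :
  #|cell a b t.+1 X Y| =
  (\sum_(w : 'I_5 * 'I_5) #|cell a b t (5 * X + w.1) (5 * Y + w.2)|)%N.
Proof.
pose f i : 'I_5 * 'I_5 := (inord (a i %/ 5 ^ t %% 5), inord (b i %/ 5 ^ t %% 5)).
rewrite -sum1_card (partition_big f xpredT) //=.
apply: eq_bigr => -[u v] _; rewrite -sum1_card; apply: eq_bigl => i /=.
apply/andP/idP => [[iXY /eqP[<- <-]]|iuv].
  rewrite /f !inE !inordK ?ltn_pmod //; move: iXY.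
  rewrite !inE expnSr !divnMA => /andP[/eqP<- /eqP<-].
  by rewrite ![(5 * _)%N]mulnC -!divn_eq !eqxx.
split; first exact: mem_subcell iuv.
move: iuv; rewrite !inE /f => /andP[/eqP-> /eqP->]; apply/eqP.
by rewrite !(mulnC 5) !modnMDl !modn_small // !inord_val.
Qed.

Lemma card_cell0 (I : finType) (a b : I -> nat) (X Y : nat) :
  injective (fun i => (a i, b i)) -> (#|cell a b 0 X Y| <= 1)%N.
Proof.
move=> inj_ab; apply/card_le1_eqP => i j; rewrite !inE expn0 !divn1.
move=> /andP[/eqP ai /eqP bi] /andP[/eqP aj /eqP bj].
by apply: inj_ab; rewrite ai bi aj bj.
Qed.

Lemma card_cell_le (I : finType) (a b : I -> nat) (t X Y : nat) :
  injective (fun i => (a i, b i)) -> (#|cell a b t X Y| <= 25 ^ t)%N.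
Proof.
move=> inj_ab; elim: t X Y => [|t IHt] X Y; first exact: card_cell0.
rewrite card_cell_rec; apply: (@leq_trans (\sum_(w : 'I_5 * 'I_5) 25 ^ t)%N).
  exact: leq_sum.
by rewrite sum_nat_const card_prod card_ord expnS.
Qed.

Lemma ltn_div (m n d : nat) : (m %/ d < n %/ d)%N -> (m < n)%N.
Proof. by apply: contraTT; rewrite -!leqNgt; apply: leq_div2r. Qed.

(* Either all 25 subcells are inhabited, and 9 of them give the pattern, or one
   is empty and one of the other 24 is again too crowded. *)
Lemma hash_cell (I : finType) (a b : I -> nat) (t X Y : nat) :
  injective (fun i => (a i, b i)) -> (24 ^ t < #|cell a b t X Y|)%N ->
  exists h v q, hash_pattern (fun i j => (a i < a j)%N)
    (fun i j => (b i < b j)%N) (cell a b t X Y) h v q.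
Proof.
move=> inj_ab; elim: t X Y => [|t IHt] X Y.
  by rewrite expn0 ltnNge card_cell0.
pose sub (w : 'I_5 * 'I_5) := cell a b t (5 * X + w.1) (5 * Y + w.2).
have [/existsP[w wlt] _|/existsPn small] :=
    boolP [exists w, 24 ^ t < #|sub w|]%N.
  have [h [v [q [qD hvD Hx Hy]]]] := IHt _ _ wlt.
  have sD := @mem_subcell _ a b t X Y _ _ (ltn_ord w.1) (ltn_ord w.2).
  exists h, v, q; split=> //; first by apply: sD.
  by move=> e s; have [hD vD] := hvD e s; split; apply: sD.
rewrite card_cell_rec => big.
have [/existsP[w0 w0E]|/existsPn full] := boolP [exists w, #|sub w| == 0]%N.
  move: big; rewrite ltnNge (bigD1 w0) //= (eqP w0E) add0n => /negP[].
  (* With one child empty and at most [24 ^ t] points in each of the other 24, the square could not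
     be crowded. *)
  apply: (@leq_trans (\sum_(w | w != w0) 24 ^ t)%N).
    by apply: leq_sum => w _; rewrite leqNgt small.
  rewrite sum_nat_const (cardC1 w0) card_prod card_ord.
  by rewrite expnS.
have [g gP] : exists g : 'I_5 * 'I_5 -> I, forall w, g w \in sub w.
  apply: (@fin_all_exists _ (fun=> I) (fun w i => i \in sub w)) => w; have := full w.
  by rewrite cards_eq0 => /finset.set0Pn[i ?]; exists i.
have ga (w w' : 'I_5 * 'I_5) : (w.1 < w'.1)%N -> (a (g w) < a (g w'))%N.
  move=> ww'; apply: (@ltn_div _ _ (5 ^ t)).
  have := gP w; have := gP w'; rewrite !inE.
  by move=> /andP[/eqP-> _] /andP[/eqP-> _]; rewrite ltn_add2l.
have gb (w w' : 'I_5 * 'I_5) : (w.2 < w'.2)%N -> (b (g w) < b (g w'))%N.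
  move=> ww'; apply: (@ltn_div _ _ (5 ^ t)).
  have := gP w; have := gP w'; rewrite !inE.
  by move=> /andP[_ /eqP->] /andP[_ /eqP->]; rewrite ltn_add2l.
have gD w : g w \in cell a b t.+1 X Y by apply: mem_subcell (gP w).
pose i k : 'I_5 := inord k.
pose inner e := i (if e then 3 else 1); pose outer s := i (if s then 4 else 0).
exists (fun e s => g (outer s, inner e)), (fun e s => g (inner e, outer s)).
exists (g (i 2, i 2)); split=> // e s.
- by split; apply: ga; rewrite /inner /outer /= !inordK //; case: (s).
- by split; apply: gb; rewrite /inner /outer /= !inordK //; case: (s).
Qed.

Definition crowded (I : finType) (a b : I -> nat) (t M : nat) :
    {set 'I_M * 'I_M} :=
  [set C | (24 ^ t < #|cell a b t (val C.1) (val C.2)|)%N].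

(** Each of the [M ^ 2] squares is charged [24 ^ t] points, and a crowded one a further [25 ^ t],
    which is the most that a square can hold. *)
Lemma card_crowded (I : finType) (a b : I -> nat) (t M : nat) :
  injective (fun i => (a i, b i)) ->
  (forall i, a i %/ 5 ^ t < M)%N -> (forall i, b i %/ 5 ^ t < M)%N ->
  (#|I| <= M ^ 2 * 24 ^ t + #|crowded a b t M| * 25 ^ t)%N.
Proof.
move=> inj_ab aM bM.
pose f i : 'I_M * 'I_M := (Ordinal (aM i), Ordinal (bM i)).
have -> : #|I| = (\sum_(i : I) 1)%N by rewrite sum1_card.
rewrite (partition_big f xpredT) //=.
apply: (@leq_trans (\sum_(C : 'I_M * 'I_M)
    (24 ^ t + (C \in crowded a b t M) * 25 ^ t))%N).
  apply: leq_sum => C _.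
  have -> : (\sum_(i | f i == C) 1 = #|cell a b t (val C.1) (val C.2)|)%N.
    rewrite -sum1_card; apply: eq_bigl => i; rewrite !inE /f.
    by case: C => c1 c2; rewrite xpair_eqE -!val_eqE.
  rewrite inE; case: ltnP => [_|le24].
    by rewrite mul1n; apply: leq_trans (leq_addl _ _); apply: card_cell_le.
  by rewrite mul0n addn0.
rewrite big_split /= sum_nat_const card_prod card_ord -mulnn.
by rewrite -big_distrl /= -big_mkcond /= sum1_card.
Qed.

(** Pigeonhole over nine residue pairs. Distinct squares of one class differ by at least 3 in some
    index, so two squares fit between them. *)
Lemma residue_class (M : nat) (G : {set 'I_M * 'I_M}) :
  exists r : 'I_3 * 'I_3,
    (#|G| <= 9 * #|[set C in G | (C.1 %% 3 == r.1)%N && (C.2 %% 3 == r.2)%N]|)%N.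
Proof.
pose f (C : 'I_M * 'I_M) : 'I_3 * 'I_3 := (inord (C.1 %% 3), inord (C.2 %% 3)).
apply/existsP; apply: contraT => /existsPn small.
rewrite -(ltnn (9 * #|G|)).
rewrite -{1}(sum1_card (mem G)) (partition_big f xpredT) //= big_distrr /=.
apply: (@leq_trans (\sum_(r : 'I_3 * 'I_3) (#|G|.-1)).+1).
  rewrite ltnS; apply: leq_sum => r _.
  have := small r; rewrite -ltnNge.
  have -> : #|[set C in G | (C.1 %% 3 == r.1)%N && (C.2 %% 3 == r.2)%N]|
    = (\sum_(C in G | f C == r) 1)%N.
    rewrite -sum1_card; apply: eq_bigl => C; rewrite inE /f; congr (_ && _).
    case: r => r1 r2; rewrite xpair_eqE -!val_eqE /= !inordK ?ltn_pmod //.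
  by case: #|G| => // g; rewrite ltnS.
rewrite sum_nat_const card_prod card_ord.
have := small (ord0, ord0); rewrite -ltnNge => /(leq_ltn_trans (leq0n _)).
by case: #|G| => // g _ /=; rewrite !mulnS; lia.
Qed.

(** * One # pattern yields one crossing *)

Lemma signs_of_if (R : realDomainType) (t : R) (b : bool) :
  (if b then t < 0 else 0 < t) -> (t < 0) = b /\ (0 < t) = ~~ b.
Proof. by case: b => t0; rewrite t0 lt_gtF. Qed.

(** Nothing places [x] and [y] in [D]; the last clause bounds their distance instead, which later
    keeps them away from the chords of other squares. *)
Lemma hash_crossing (R : realType) (n : nat) (p : 'I_n -> pt R)
    (D : {set 'I_n}) (h v : bool -> bool -> 'I_n) (q : 'I_n) :
  generic p ->
  hash_pattern (fun i j => (p i).1 < (p j).1) (fun i j => (p i).2 < (p j).2)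
    D h v q ->
  exists c d x y : 'I_n,
    [/\ c \in D, d \in D, (c < d)%N, (x < y)%N
      & seg_cross (p x) (p y) (p c) (p d)] /\
    [/\ x \notin [set c; d], y \notin [set c; d],
        forall A : {set 'I_n}, x \in A -> y \in A -> [set x; y] \in mst p A
      & exists i j, [/\ i \in D, j \in D & dist (p x) (p y) <= dist (p i) (p j)]].
Proof.
move=> [injp [gp uniq_mst]] [qD hvD Hx Hy].
(* The chords are oriented so that [p q] lies to the left of all of them. *)
pose ca (k : bool * bool) := if k.1 then v k.2 (~~ k.2) else h k.2 k.2.
pose cb (k : bool * bool) := if k.1 then v k.2 k.2 else h k.2 (~~ k.2).
pose f k := det (p (ca k)) (p (cb k)).
have caD k : ca k \in D /\ cb k \in D.
  case: k => [[] e]; rewrite /ca /cb /=.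
    by have [_ ?] := hvD e e; have [_ ?] := hvD e (~~ e).
  by have [? _] := hvD e e; have [? _] := hvD e (~~ e).
(* Left ends of horizontal chords lie beyond the left vertical chord and on the inner side of the
   right one; for right ends it is the reverse. *)
have fv e e' s :
    (f (true, e') (p (h e s)) < 0) = (s == e') /\
    (0 < f (true, e') (p (h e s))) = (s != e').
  suff : if s == e' then f (true, e') (p (h e s)) < 0
         else 0 < f (true, e') (p (h e s)).
    exact: signs_of_if.
  have [x1 x2 x3 x4] := Hx e false; have [x5 x6 x7 x8] := Hx e true.
  have [y1 y2 y3 y4] := Hy e' s; have y5 : (p (v e' false)).2 < (p (h e s)).2
    < (p (v e' true)).2 by case: (e); apply/andP; split; lra.
  case: e' {y1 y4} y5 => y5; case: s {y2 y3} y5 => y5; rewrite /f /ca /cb /=.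
  - by apply: det_right => //; lra.
  - by apply: det_left => //; lra.
  - by rewrite det_swap oppr_gt0; apply: det_right => //; lra.
  - by rewrite det_swap oppr_lt0; apply: det_left => //; lra.
have fh e e' s :
    (f (false, e') (p (v e s)) < 0) = (s == e') /\
    (0 < f (false, e') (p (v e s))) = (s != e').
  suff : if s == e' then f (false, e') (p (v e s)) < 0
         else 0 < f (false, e') (p (v e s)).
    exact: signs_of_if.
  have [y1 y2 y3 y4] := Hy e false; have [y5 y6 y7 y8] := Hy e true.
  have [x1 x2 x3 x4] := Hx e' s; have x5 : (p (h e' false)).1 < (p (v e s)).1
    < (p (h e' true)).1 by case: (e); apply/andP; split; lra.
  case: e' {x1 x4} x5 => x5; case: s {x2 x3} x5 => x5; rewrite /f /ca /cb /=.
  - by rewrite det_swap oppr_lt0; apply: det_above => //; lra.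
  - by rewrite det_swap oppr_gt0; apply: det_below => //; lra.
  - by apply: det_above => //; lra.
  - by apply: det_below => //; lra.
have fq k : 0 < f k (p q).
  have [x1 x2 x3 x4] := Hx false false; have [x5 x6 x7 x8] := Hx false true.
  have [x9 _ _ x10] := Hx true false.
  have [y1 y2 y3 y4] := Hy false false; have [y5 y6 y7 y8] := Hy false true.
  have [y9 _ _ y10] := Hy true false.
  case: k => [[] []]; rewrite /f /ca /cb /=.
  - by apply: det_left; first (apply/andP; split); lra.
  - rewrite det_swap oppr_gt0.
    by apply: det_right; first (apply/andP; split); lra.
  - rewrite det_swap oppr_gt0.
    by apply: det_below; first (apply/andP; split); lra.
  - by apply: det_above; first (apply/andP; split); lra.
(* Some transversal chord separates the two ends of chord [k], with the start on the outer side;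
   [outb] does the same for the other end. *)
have outa k : exists j, f j (p (ca k)) < 0 < f j (p (cb k)).
  case: k => [[] e]; rewrite /ca /cb /=.
    by exists (false, ~~ e); rewrite (fh _ _ _).1 (fh _ _ _).2; case: (e).
  by exists (true, e); rewrite (fv _ _ _).1 (fv _ _ _).2; case: (e).
have outb k : exists j, f j (p (cb k)) < 0 < f j (p (ca k)).
  case: k => [[] e]; rewrite /ca /cb /=.
    by exists (false, e); rewrite (fh _ _ _).1 (fh _ _ _).2; case: (e).
  by exists (true, ~~ e); rewrite (fv _ _ _).1 (fv _ _ _).2; case: (e).
pose X := [set i | [forall k, 0 < f k (p i)]].
have qX : q \in X by rewrite inE; apply/forallP.
have hX : h false false \notin X.
  rewrite inE negb_forall; apply/existsP; exists (true, false).
  by rewrite (fv _ _ _).2.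
(* The pair of [q] and [h false false] is the initial candidate, and its distance gives the final
   length bound. *)
have [[x y] /andP[/= xX yX] minxy] := @arg_minP _ R _ (q, h false false)
  (fun w : 'I_n * 'I_n => (w.1 \in X) && (w.2 \notin X))
  (fun w => dist (p w.1) (p w.2)) (introT andP (conj qX hX)).
have xF k : 0 < f k (p x) by move: xX; rewrite inE => /forallP.
(* A point outside [X] might lie on the line of a chord. Then it is an end of that chord, cut off by
   another one, or three points are collinear. *)
have yF : exists k, f k (p y) < 0.
  move: (yX); rewrite inE negb_forall => /existsP[k]; rewrite -leNgt le_eqVlt.
  case/orP=> [/eqP fk0|]; last by exists k.
  have [yca|yca] := eqVneq (ca k) y.
    by have [j /andP[? _]] := outa k; exists j; rewrite -yca.
  have [ycb|ycb] := eqVneq (cb k) y.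
    by have [j /andP[? _]] := outb k; exists j; rewrite -ycb.
  have cab : ca k != cb k.
    by apply/eqP => E; have [j] := outa k; rewrite E => /andP[/lt_trans H /H];
      rewrite ltxx.
  by case: (gp _ _ _ cab ycb yca).
have [k [yk]] := exit_crosses_chord outa outb xF yF.
rewrite -/(f k) in yk => cross.
(* [f k] vanishes at both ends of the chord but is positive at [x] and negative at [y], so neither
   of these is an end. *)
have fca : f k (p (ca k)) = 0 by rewrite /f /det; ring.
have fcb : f k (p (cb k)) = 0 by rewrite /f /det; ring.
have xny : x != y by apply: contraNneq yX => <-.
have xc : x \notin [set ca k; cb k].
  rewrite !inE; apply/negP => /orP[]/eqP E; have := xF k; rewrite E.
    by rewrite fca ltxx.
  by rewrite fcb ltxx.
have yc : y \notin [set ca k; cb k].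
  rewrite !inE; apply/negP => /orP[]/eqP E; move: yk; rewrite E.
    by rewrite fca ltxx.
  by rewrite fcb ltxx.
have cab : ca k != cb k.
  by apply/eqP => E; have [j] := outa k; rewrite E => /andP[/lt_trans H /H];
    rewrite ltxx.
have xyA (A : {set 'I_n}) : x \in A -> y \in A -> [set x; y] \in mst p A.
  move=> xA yA; apply: mst_cut (uniq_mst A) xA yA xX yX _ => u w _ _ uX wX.
  by apply: (minxy (u, w)); rewrite /= uX.
have short : exists i j,
    [/\ i \in D, j \in D & dist (p x) (p y) <= dist (p i) (p j)].
  exists q, (h false false); split=> //; first by have [] := hvD false false.
  by apply: (minxy (q, h false false)); rewrite /= qX.
have [caDk cbDk] := caD k.
move: (ca k) (cb k) caDk cbDk cab cross xc yc => {f ca cb caD fv fh fq outa outb X qX hX xX yX minxy xF yF yk fca fcb}.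
move=> c d cD dD cd cross xc yc.
wlog xy : x y xny cross xc yc xyA short / (x < y)%N.
  move=> H; have [xy|yx|E] := ltngtP x y; first exact: (H x y).
    apply: (H y x) => //; first by rewrite eq_sym.
    - exact: seg_crossCl.
    - by move=> A yA xA; rewrite finset.setUC; apply: xyA.
    - by rewrite distC.
  by move: xny; rewrite (val_inj E) eqxx.
have [cd'|dc|E] := ltngtP c d; last by move: cd; rewrite (val_inj E) eqxx.
  by exists c, d, x, y.
by exists d, c, x, y; rewrite (finset.setUC [set d]); do !split=> //; apply: seg_crossCr.
Qed.

(** * Colouring many separated squares at once *)

Lemma far_cells (R : realType) (A B : nat) (w u z : R) :
  0 < w -> A = B %[mod 3] -> A <> B ->
  A%:R * w <= u < A.+1%:R * w -> B%:R * w <= z < B.+1%:R * w ->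
  2 * w < `|u - z|.
Proof.
move=> w0 AB3 AB /andP[uA uA'] /andP[zB zB'].
have [le3|le3] : (A + 3 <= B)%N \/ (B + 3 <= A)%N by lia.
  have : (A%:R + 3) * w <= B%:R * w.
    by rewrite ler_pM2r // -natrD ler_nat.
  by rewrite distrC => H; apply: lt_le_trans (ler_norm _);
    move: uA'; rewrite -natr1; lra.
have : (B%:R + 3) * w <= A%:R * w.
  by rewrite ler_pM2r // -natrD ler_nat.
by move=> H; apply: lt_le_trans (ler_norm _); move: zB'; rewrite -natr1; lra.
Qed.

Lemma close_cell (R : realType) (l w u z : R) :
  l * w <= u < (l + 1) * w -> l * w <= z < (l + 1) * w -> `|u - z| <= w.
Proof.
by move=> /andP[uA uA'] /andP[zB zB']; rewrite ler_norml; apply/andP; split; lra.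
Qed.

Lemma between_cell (R : realType) (l r u z s : R) :
  0 <= s <= 1 -> l <= u < r -> l <= z < r -> l <= u + s * (z - u) < r.
Proof.
move=> /andP[s0 s1] /andP[ul ur] /andP[zl zr]; apply/andP; split.
  by have := mulr_ge0 s0 (_ : 0 <= z - l); nra.
by have [uz|zu] := leP u z; nra.
Qed.

(** One chord per square of [D] is selected; the ends of these chords become blue and all other
    points red. Points of one square are at distance at most [2 * w], and distinct squares of [D]
    are further apart, so the selections do not interfere. *)
Lemma card_cells_le_crP (R : realType) (n : nat) (p : 'I_n -> pt R)
    (a b : 'I_n -> nat) (t M : nat) (D : {set 'I_M * 'I_M}) (w : R) (o : pt R) :
  generic p -> 0 < w ->
  (forall i, (a i %/ 5 ^ t)%:R * w <= (p i).1 - o.1 < (a i %/ 5 ^ t).+1%:R * w) ->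
  (forall i, (b i %/ 5 ^ t)%:R * w <= (p i).2 - o.2 < (b i %/ 5 ^ t).+1%:R * w) ->
  {in D, forall C, exists h v q,
    hash_pattern (fun i j => (p i).1 < (p j).1) (fun i j => (p i).2 < (p j).2)
      (cell a b t (val C.1) (val C.2)) h v q} ->
  {in D &, forall C C' : 'I_M * 'I_M,
    C.1 = C'.1 %[mod 3] /\ C.2 = C'.2 %[mod 3]} ->
  (#|D| <= crP p)%N.
Proof.
move=> genp w0 aw bw hashD sepD.
have [->|/finset.set0Pn[C0 C0D]] := eqVneq D finset.set0; first by rewrite cards0.
(* Any index will do: [i0] is the default value of the choice function outside [D]. *)
have [_ [_ [i0 _]]] := hashD _ C0D.
pose Q (C : 'I_M * 'I_M) := cell a b t (val C.1) (val C.2).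
have close C i j : i \in Q C -> j \in Q C -> dist (p i) (p j) <= 2 * w.
  rewrite !inE => /andP[/eqP ai /eqP bi] /andP[/eqP aj /eqP bj].
  apply: le_trans (dist_le_normB _ _) _.
  have := aw i; have := aw j; have := bw i; have := bw j.
  rewrite ai aj bi bj -!natr1 => b1 b2 a1 a2.
  have := close_cell a1 a2; have := close_cell b1 b2.
  rewrite !opprB !addrA !subrK (distrC (p j).1) (distrC (p j).2); lra.
(* Here [z] is any point of the square [C], because it will also be a crossing point of two
   segments. *)
have far C C' (z : pt R) i : C \in D -> C' \in D -> C <> C' -> i \in Q C' ->
    (val C.1)%:R * w <= z.1 - o.1 < (val C.1).+1%:R * w ->
    (val C.2)%:R * w <= z.2 - o.2 < (val C.2).+1%:R * w ->
    2 * w < `|(p i).1 - z.1| \/ 2 * w < `|(p i).2 - z.2|.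
  move=> CD C'D CC'; rewrite inE => /andP[/eqP ai /eqP bi] z1 z2.
  have [m1 m2] := sepD _ _ C'D CD.
  have sh (u v o' : R) : u - v = (u - o') - (v - o') by ring.
  have [E1|N1] := eqVneq (val C'.1) (val C.1).
    right; rewrite (sh _ _ o.2); apply: (@far_cells _ (val C'.2) (val C.2)) => //.
      move=> E2; apply: CC'; rewrite (surjective_pairing C) (surjective_pairing C').
      by rewrite (val_inj E1) (val_inj E2).
    by rewrite -bi.
  left; rewrite (sh _ _ o.1); apply: (@far_cells _ (val C'.1) (val C.1)) => //; first exact/eqP.
  by rewrite -ai.
pose good C (g : ('I_n * 'I_n) * ('I_n * 'I_n)) :=
  [/\ g.2.1 \in Q C, g.2.2 \in Q C, (g.2.1 < g.2.2)%N, (g.1.1 < g.1.2)%N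
      & seg_cross (p g.1.1) (p g.1.2) (p g.2.1) (p g.2.2)] /\
  [/\ g.1.1 \notin [set g.2.1; g.2.2], g.1.2 \notin [set g.2.1; g.2.2],
      forall A : {set 'I_n}, g.1.1 \in A -> g.1.2 \in A ->
        [set g.1.1; g.1.2] \in mst p A
    & dist (p g.1.1) (p g.1.2) <= 2 * w].
have [g gP] : exists g : 'I_M * 'I_M -> ('I_n * 'I_n) * ('I_n * 'I_n),
    forall C, C \in D -> good C (g C).
  apply: (@fin_all_exists _ (fun=> _) (fun C g => C \in D -> good C g)) => C.
  have [CD|CD] := boolP (C \in D); last by exists ((i0, i0), (i0, i0)).
  have [h [v [q hq]]] := hashD _ CD.
  have [c [d [x [y [H [? ? ? [i [j [iC jC le_ij]]]]]]]]] := hash_crossing genp hq.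
  exists ((x, y), (c, d)) => _; split=> //; split=> //=.
  exact: le_trans le_ij (close _ _ _ iC jC).
pose B := [set i | [exists C in D, i \in [set (g C).2.1; (g C).2.2]]].
have inB C i : C \in D -> i \in [set (g C).2.1; (g C).2.2] -> i \in B.
  by move=> CD iC; rewrite inE; apply/existsP; exists C; rewrite CD.
have inQ C i : C \in D -> i \in [set (g C).2.1; (g C).2.2] -> i \in Q C.
  by move=> /gP[[? ? _ _ _] _]; rewrite in_set2 => /orP[]/eqP->.
have cellP C i : i \in Q C ->
    (val C.1)%:R * w <= (p i).1 - o.1 < (val C.1).+1%:R * w /\
    (val C.2)%:R * w <= (p i).2 - o.2 < (val C.2).+1%:R * w.
  by rewrite inE => /andP[/eqP<- /eqP<-].
(* Otherwise [x] is a chord end in another square, more than [2 * w] from the crossing point; but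
   that point lies on the segment from [x] to [y], whose length is at most [2 * w]. *)
have red C x y c d : C \in D -> c \in Q C -> d \in Q C -> 
    x \notin [set (g C).2.1; (g C).2.2] -> dist (p x) (p y) <= 2 * w ->
    seg_cross (p x) (p y) (p c) (p d) -> x \notin B.
  move=> CD cQ dQ xC xyw [u [s [/andP[u0 u1] [s01 [E1 E2]]]]].
  apply/negP; rewrite inE => /existsP[C' /andP[C'D xC']].
  have [E|/eqP CC'] := eqVneq C C'; first by move: xC; rewrite E xC'.
  have [c1 c2] := cellP _ _ cQ; have [d1 d2] := cellP _ _ dQ.
  have := @far _ _ (along (p c) (p d) s) _ CD C'D CC' (inQ _ _ C'D xC').
  have sh (e f o' : R) : e + s * (f - e) - o' = (e - o') + s * ((f - o') - (e - o')).
    by ring.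
  rewrite /along /= !sh !between_cell // -E1 -E2 => /(_ isT isT).
  have [dx dy] := normB_le_dist (p x) (p y).
  have le_u (r r' : R) : `|r - (r + u * (r' - r))| <= `|r - r'|.
    have -> : r - (r + u * (r' - r)) = u * (r - r') by ring.
    by rewrite normrM (ger0_norm u0) ler_piMl.
  have := le_u (p x).1 (p y).1; have := le_u (p x).2 (p y).2.
  by move=> ? ? []; lra.
have blue C : C \in D -> [set (g C).2.1; (g C).2.2] \in mst p B.
  move=> CD; have [[cQ dQ cd _ _] _] := gP _ CD.
  set c := (g C).2.1 in cQ cd *; set d := (g C).2.2 in dQ cd *.
  have cB : c \in B by apply: inB CD _; rewrite set21.
  have dB : d \in B by apply: inB CD _; rewrite set22.
  (* Cutting off [c] alone suffices: blue points other than [c] and [d] lie in other squares, so [d]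
     is a nearest blue neighbour of [c]. *)
  apply: (@mst_cut _ _ p B [set c]) => //; first exact: (genp.2.2 B).
  - by rewrite inE.
  - by rewrite inE; apply: contraTneq cd => ->; rewrite ltnn.
  move=> u v _; rewrite !inE => /existsP[C' /andP[C'D vC']] /eqP-> vc.
  have [E|/eqP CC'] := eqVneq C C'.
    by move: vC'; rewrite -E !inE (negPf vc) /= => /eqP->.
  apply: le_trans (close _ _ _ cQ dQ) _.
  have [c1 c2] := cellP _ _ cQ.
  have := far _ _ (p c) _ CD C'D CC' (inQ _ _ C'D vC') c1 c2.
  have [dx dy] := normB_le_dist (p v) (p c).
  by rewrite (distC (p c)) => -[]; lra.
(* A chord end determines its square. *)
have injg : {in D &, injective g}.
  move=> C C' CD C'D E; have [[+ _ _ _ _] _] := gP _ CD.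
  have [[+ _ _ _ _] _] := gP _ C'D.
  rewrite E !inE => /andP[/eqP E1 /eqP E2]; rewrite E1 E2 => /andP[/eqP E3 /eqP E4].
  by rewrite (surjective_pairing C) (surjective_pairing C') -(val_inj E3) -(val_inj E4).
rewrite -(card_in_imset injg).
(* The red class is [~: B], which leaves [B] as the other class. *)
apply: leq_trans (leq_bigmax (~: B)); rewrite finset.setCK /cr.
apply: subset_leq_card; apply/fintype.subsetP => _ /imsetP[C CD ->].
have [[cQ dQ cd xy cross] [xcd ycd mstxy xyw]] := gP _ CD.
have xB := red _ _ _ _ _ CD cQ dQ xcd xyw cross.
have yB : (g C).1.2 \notin B.
  by apply: red CD cQ dQ ycd _ (seg_crossCl cross); rewrite distC.
rewrite inE cd xy blue // mstxy ?finset.in_setC ?xB ?yB //=.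
exact/asboolP.
Qed.

(** * Choice of constants and the final count *)

Lemma truncn_divn_itv (R : archiRealFieldType) (u eps : R) (k : nat) :
  0 < eps -> 0 <= u -> (0 < k)%N ->
  (Num.truncn (u / eps) %/ k)%:R * (eps * k%:R) <= u <
  (Num.truncn (u / eps) %/ k).+1%:R * (eps * k%:R).
Proof.
move=> eps0 u0 k0; have := truncn_itv (divr_ge0 u0 (ltW eps0)).
set m := Num.truncn _; rewrite ler_pdivlMr // ltr_pdivrMr // => /andP[lo hi].
rewrite (mulrC eps) !mulrA -!natrM; apply/andP; split.
  by apply: le_trans lo; rewrite ler_pM2r // ler_nat leq_divM.
by apply: lt_le_trans hi _; rewrite ler_pM2r // ler_nat ltn_ceil.
Qed.

(** Bernoulli's inequality for [25 / 24], in the form [bern] without division. *)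
Lemma exists_expr_small (R : archiRealFieldType) (x : R) :
  0 < x -> exists t, 24 ^+ t * x <= 25 ^+ t.
Proof.
move=> x0; pose t := Num.bound (24 * x); exists t.
have xt : 24 * x <= t%:R.
  by apply: ltW; apply: archi_boundP; rewrite mulr_ge0 // ltW.
have bern k : 24 ^+ k * (24 + k%:R) <= 24 * 25 ^+ k :> R.
  elim: k => [|k IHk]; first by rewrite !expr0; lra.
  have p0 : 0 <= 24 ^+ k :> R by rewrite exprn_ge0.
  have pk : 0 <= 24 ^+ k * k%:R :> R by rewrite mulr_ge0.
  rewrite !exprS -(natr1 k); move: (24 ^+ k) (25 ^+ k) k%:R IHk pk {p0} => u v m.
  by nra.
have p0 : 0 <= 24 ^+ t :> R by rewrite exprn_ge0.
have := ler_wpM2l p0 xt; have := bern t; lra.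
Qed.

Lemma min_dist (R : realType) (n : nat) (p : 'I_n -> pt R) :
  (1 < n)%N -> injective p ->
  exists k l, [/\ k != l, 0 < dist (p k) (p l)
    & forall i j, i != j -> dist (p k) (p l) <= dist (p i) (p j)].
Proof.
move=> n1 injp.
have k0l0 : Ordinal (ltnW n1) != Ordinal n1 by [].
have [[k l] /= kl min_kl] := @arg_minP _ R _ (Ordinal (ltnW n1), Ordinal n1)
  (fun w : 'I_n * 'I_n => w.1 != w.2) (fun w => dist (p w.1) (p w.2)) k0l0.
exists k, l; split=> // [|i j ij]; last exact: (min_kl (i, j)).
rewrite sqrtr_gt0 lt_neqAle addr_ge0 ?sqr_ge0 // andbT eq_sym.
rewrite paddr_eq0 ?sqr_ge0 // !sqrf_eq0 !subr_eq0; apply: contraNN kl.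
move=> /andP[/eqP E1 /eqP E2]; apply/eqP/injp.
by rewrite (surjective_pairing (p k)) (surjective_pairing (p l)) E1 E2.
Qed.

Theorem theorem7 (R : realType) (alpha : R) :
  Num.sqrt 2 * Num.sqrt (Num.sqrt 3) / Num.sqrt pi <= alpha ->
  exists c : R, 0 < c /\
  exists n0 : nat,
    forall (n : nat) (p : 'I_n -> pt R),
      (n0 <= n)%N -> generic p -> dense p alpha ->
      c * n%:R <= (crP p)%:R.
Proof.
move=> le_alpha.
have alpha0 : 0 < alpha.
  apply: lt_le_trans le_alpha.
  by rewrite divr_gt0 ?mulr_gt0 ?sqrtr_gt0 ?pi_gt0.
(* For this [t] and large [n], squares that are not crowded hold at most [n / 2] points in total. *)
have [t small_t] : exists t, 24 ^+ t * (128 * alpha ^+ 2) <= 25 ^+ t :> R.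
  by apply: exists_expr_small; rewrite mulr_gt0 // exprn_gt0.
have pow_gt0 (k : nat) : (0 < k)%N -> 0 < k%:R ^+ t :> R.
  by move=> k0; rewrite exprn_gt0 ?ltr0n.
(* At least [n / 2] points lie in crowded squares, with at most [25 ^ t] in each, and a ninth of
   these squares is kept. *)
exists (18 * 25 ^+ t)^-1; split.
  by rewrite invr_gt0 mulr_gt0 // pow_gt0.
(* [T <= sqrt n] means that [4 * alpha * sqrt n / 5 ^ t] is at least 1, which absorbs the rounding
   up in [M]. *)
pose T := 5 ^+ t / (4 * alpha).
have T0 : 0 <= T by rewrite divr_ge0 ?mulr_ge0 // ltW // pow_gt0.
exists (maxn 2 (Num.bound (T ^+ 2))) => n p; rewrite geq_max => /andP[n1 nT] genp densep.
have sT : T <= Num.sqrt n%:R.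
  rewrite -(ger0_norm T0) -sqrtr_sqr; apply/ler_wsqrtr/ltW.
  by apply: lt_le_trans (archi_boundP (sqr_ge0 T)) _; rewrite ler_nat.
have [injp _] := genp.
have [k0 [l0 [kl0 delta0 min_delta]]] := min_dist n1 injp.
set delta := dist (p k0) (p l0) in delta0 min_delta.
pose S := alpha * Num.sqrt n%:R * delta.
have diam i j : dist (p i) (p j) < S by apply: densep.
(* All points are within [S] of [p k0], so relative to this origin their coordinates lie between 0
   and [2 * S]. *)
pose o : pt R := ((p k0).1 - S, (p k0).2 - S).
(* Two points in a square of side [delta / 2] would be closer than [delta], so a finest square holds
   at most one point. *)
pose eps := delta / 2.
have eps0 : 0 < eps by rewrite divr_gt0.
pose a i := Num.truncn (((p i).1 - o.1) / eps).
pose b i := Num.truncn (((p i).2 - o.2) / eps).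
have rng i : (0 <= (p i).1 - o.1 < 2 * S) /\ (0 <= (p i).2 - o.2 < 2 * S).
  have := diam i k0; have [d1 d2] := normB_le_dist (p i) (p k0).
  have := ler_norm ((p i).1 - (p k0).1); have := ler_norm (- ((p i).1 - (p k0).1)).
  have := ler_norm ((p i).2 - (p k0).2); have := ler_norm (- ((p i).2 - (p k0).2)).
  by rewrite !normrN /o /=; split; apply/andP; split; lra.
have ge0_1 i : 0 <= (p i).1 - o.1 by have [/andP[]] := rng i.
have ge0_2 i : 0 <= (p i).2 - o.2 by have [_ /andP[]] := rng i.
have five0 : (0 < 5 ^ t)%N by rewrite expn_gt0.
pose w := eps * (5 ^ t)%:R.
have w0 : 0 < w by rewrite mulr_gt0 // ltr0n.
have aw i := truncn_divn_itv eps0 (ge0_1 i) five0.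
have bw i := truncn_divn_itv eps0 (ge0_2 i) five0.
have inj_ab : injective (fun i => (a i, b i)).
  move=> i j [Ea Eb]; apply/eqP; apply: contraT => /min_delta.
  rewrite leNgt => /negP[].
  have close1 (u v u' : R) : 0 <= u - u' -> 0 <= v - u' ->
      Num.truncn ((u - u') / eps) = Num.truncn ((v - u') / eps) ->
      (u - v) ^+ 2 < eps ^+ 2.
    move=> u0 v0 E; have := truncn_divn_itv eps0 u0 (isT : 0 < 1)%N.
    have := truncn_divn_itv eps0 v0 (isT : 0 < 1)%N.
    rewrite E; set m := (_ %/ 1)%N; rewrite !mulr1 -(natr1 m) => /andP[x1 x2] /andP[x3 x4].
    by rewrite -[ltLHS]real_normK ?num_real // ltr_pXn2r ?nnegrE ?normr_ge0 ?ltW //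
      ltr_norml; apply/andP; split; lra.
  have s1 := close1 _ _ _ (ge0_1 i) (ge0_1 j) Ea.
  have s2 := close1 _ _ _ (ge0_2 i) (ge0_2 j) Eb.
  rewrite -(ger0_norm (ltW delta0)) -sqrtr_sqr /dist ltr_sqrt ?exprn_gt0 //.
  have e2 : delta ^+ 2 = 4 * eps ^+ 2 by rewrite /eps; field.
  have : 0 < eps ^+ 2 by rewrite exprn_gt0.
  by lra.
pose M := (Num.truncn (2 * S / w)).+1.
have ltM (u : R) : 0 <= u < 2 * S -> (Num.truncn (u / eps) %/ 5 ^ t < M)%N.
  move=> /andP[u0 uS]; rewrite /M ltnS -ltnS -(ltr_nat R).
  have /andP[lo _] := truncn_divn_itv eps0 u0 five0.
  have S0 : 0 <= 2 * S / w by rewrite divr_ge0 ?(ltW w0) // ltW // (le_lt_trans u0).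
  have /andP[_] := truncn_itv S0; apply: le_lt_trans.
  by rewrite ler_pdivlMr //; apply: ltW; apply: le_lt_trans lo uS.
have aM i : (a i %/ 5 ^ t < M)%N by apply: ltM; case: (rng i).
have bM i : (b i %/ 5 ^ t < M)%N by apply: ltM; case: (rng i).
have [r le_r] := residue_class (crowded a b t M).
set D := [set C in _ | _] in le_r.
have : (#|D| <= crP p)%N.
  apply: (card_cells_le_crP genp w0 (aw : forall i, _) (bw : forall i, _)).
    move=> C; rewrite inE => /andP[+ _]; rewrite inE => big.
    have [h [v [q [qD hvD Hx Hy]]]] := hash_cell inj_ab big.
    (* Strict order of grid coordinates passes to the real ones, so a pattern on the grid is a
       pattern in the plane. *)
    have mono (u v' : R) : 0 <= v' -> (Num.truncn (u / eps) < Num.truncn (v' / eps))%N ->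
        u < v'.
      move=> v0; rewrite ltNge; apply: contraL => le_vu; rewrite -leqNgt.
      by apply: le_truncn; rewrite ler_pM2r ?invr_gt0.
    have mono1 i j : (a i < a j)%N -> (p i).1 < (p j).1.
      by move=> /(mono _ _ (ge0_1 j)); rewrite ltrD2r.
    have mono2 i j : (b i < b j)%N -> (p i).2 < (p j).2.
      by move=> /(mono _ _ (ge0_2 j)); rewrite ltrD2r.
    exists h, v, q; split=> // e s.
      by have [? ? ? ?] := Hx e s; split; apply: mono1.
    by have [? ? ? ?] := Hy e s; split; apply: mono2.
  move=> C C'; rewrite !inE => /andP[_ /andP[/eqP E1 /eqP E2]].
  by move=> /andP[_ /andP[/eqP E3 /eqP E4]]; rewrite E1 E2 E3 E4.
rewrite -(ler_nat R); apply: le_trans.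
have := card_crowded inj_ab aM bM.
rewrite card_ord -(ler_nat R) natrD !natrM !natrX => count.
move: le_r; rewrite -(ler_nat R) natrM => le_r.
have wE : 2 * S / w = alpha * Num.sqrt n%:R * 4 / 5 ^+ t.
  rewrite /S /w /eps natrX; field.
  by rewrite !gt_eqF ?pow_gt0.
have M_le : M%:R <= 8 * alpha * Num.sqrt n%:R / 5 ^+ t.
  have S0 : 0 <= 2 * S / w.
    by rewrite wE divr_ge0 ?mulr_ge0 ?sqrtr_ge0 // ltW // pow_gt0.
  rewrite /M -natr1; have /andP[+ _] := truncn_itv S0; rewrite wE => le_tr.
  have : 1 <= alpha * Num.sqrt n%:R * 4 / 5 ^+ t.
    rewrite ler_pdivlMr ?pow_gt0 // mul1r.
    by move: sT; rewrite /T ler_pdivrMr ?mulr_gt0 //; lra.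
  lra.
have M2 : M%:R ^+ 2 * 24 ^+ t <= n%:R / 2 :> R.
  have : M%:R ^+ 2 <= (8 * alpha * Num.sqrt n%:R / 5 ^+ t) ^+ 2.
    by rewrite ler_pXn2r ?nnegrE // (le_trans _ M_le).
  rewrite !exprMn sqr_sqrtr // exprVn -exprM mulnC exprM => le_M.
  have -> : n%:R / 2 = 64 * alpha ^+ 2 * n%:R / 25 ^+ t * (25 ^+ t / (128 * alpha ^+ 2)).
    by field; rewrite !gt_eqF ?pow_gt0.
  apply: ler_pM => //; first by rewrite exprn_ge0.
  - by rewrite ltW // pow_gt0.
  - have e5 : 5 ^+ 2 = 25 :> R by ring.
    have e8 : 8 ^+ 2 = 64 :> R by ring.
    by rewrite -e5 -e8.
  - by rewrite ler_pdivlMr // mulr_gt0 // exprn_gt0.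
(* With at most [n / 2] points charged to [M ^ 2 * 24 ^ t], the crowded squares account for the
   other half, and [D] has at least a ninth of them. *)
rewrite mulrC ler_pdivrMr; last by rewrite mulr_gt0 // pow_gt0.
have := ler_wpM2r (ltW (pow_gt0 25%N isT)) le_r; lra.
Qed.
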